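(* The standard square twist (all four sides of the central square having the same mountain-valley assignment, MMMM or VVVV) and the iso-area square twist (the sides of the central square being assigned MVMV alternately in cyclic order) become rigidly foldable when an extra crease is added along one diagonal of the central square. That is, for the augmented square twist crease pattern, and for each sign pattern $(s_1,s_2,s_3,s_4)\in\{(+,+,+,+),(-,-,-,-),(+,-,+,-),(-,+,-,+)\}$, there is a continuous path of rigid folding states starting at the unfolded state (all folding angles $0$) and ending at a flat-folded state in which the diagonal crease has folding angle $0$, all twelve other creases have folding angle $\pm\pi$, and the sides $v_1v_3$, $v_3v_2$, $v_2v_4$, $v_4v_1$ of the central square have folding angles $s_1\pi,s_2\pi,s_3\pi,s_4\pi$ respectively.
   Context: The augmented square twist is the following crease pattern in the plane (up to similarity), with 13 creases and 4 vertices. The vertices are $v_3=(-1,0)$, $v_2=(0,1)$, $v_4=(1,0)$, $v_1=(0,-1)$, the corners of the central square (diamond). The creases are: the four sides $v_1v_3$, $v_3v_2$, $v_2v_4$, $v_4v_1$ of the square; the diagonal $v_3v_4$ of the square; and eight creases running from the vertices outward to the edge of the paper (regarded as rays): from $v_3$ in directions $(0,1)$ and $(-1,0)$; from $v_2$ in directions $(0,1)$ and $(1,0)$; from $v_4$ in directions $(1,0)$ and $(0,-1)$; from $v_1$ in directions $(0,-1)$ and $(-1,0)$. The (non-augmented) square twist is the same pattern without the diagonal. Rigid folding: each crease $c$ is assigned a folding angle $\rho_c\in[-\pi,\pi]$ (signed deviation of the dihedral angle from flat; positive for valley V, negative for mountain M, $0$ for unfolded, $\pm\pi$ for folded flat).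 For $\theta,\rho\in\mathbb{R}$ let $R(\theta,\rho)\in SO(3)$ be the rotation by angle $\rho$ about the axis $(\cos\theta,\sin\theta,0)$. An assignment of folding angles is a rigid folding state (all faces stay flat and rigid) if at every vertex $v$, with incident creases $c_1,\dots,c_k$ listed counterclockwise and leaving $v$ in directions with polar angles $\theta_1,\dots,\theta_k$, one has $R(\theta_1,\rho_{c_1})R(\theta_2,\rho_{c_2})\cdots R(\theta_k,\rho_{c_k})=I$. Layer ordering and self-intersection of the paper are not taken into account. A path of rigid folding states is a continuous map from $[0,1]$ to $[-\pi,\pi]^{13}$ all of whose values are rigid folding states. A square twist with a given mountain-valley assignment is rigidly foldable if it can be folded from the unfolded state along the creases into the flat, square-twist state (all creases of the square twist folded flat) through rigid folding states. *)

(* Defs.v *)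
From mathcomp Require Import all_boot all_order all_algebra.
From mathcomp Require Import all_classical all_reals all_analysis.
From mathcomp Require Import ring lra.

Set Implicit Arguments.
Unset Strict Implicit.
Unset Printing Implicit Defensive.

Import Order.TTheory GRing.Theory Num.Theory.
Import numFieldNormedType.Exports.

Local Open Scope classical_set_scope.
Local Open Scope ring_scope.

Inductive vertex := v1 | v2 | v3 | v4.

Definition vertex_pos (R : realType) (v : vertex) : R * R :=
  match v with
  | v1 => (0, -1)
  | v2 => (0, 1)
  | v3 => (-1, 0)
  | v4 => (1, 0)
  end.

(* The rays are named after the vertex they leave and their direction. *)
Inductive crease :=
  | side13 | side32 | side24 | side41
  | diag34
  | ray3_up | ray3_left
  | ray2_up | ray2_right
  | ray4_right | ray4_down
  | ray1_down | ray1_left.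

Inductive crease_shape (R : realType) :=
  | Segment of vertex & vertex
  | Ray of vertex & R * R.

Definition shape_of (R : realType) (c : crease) : crease_shape R :=
  match c with
  | side13 => Segment R v1 v3
  | side32 => Segment R v3 v2
  | side24 => Segment R v2 v4
  | side41 => Segment R v4 v1
  | diag34 => Segment R v3 v4
  | ray3_up => Ray v3 (0, 1)
  | ray3_left => Ray v3 (-1, 0)
  | ray2_up => Ray v2 (0, 1)
  | ray2_right => Ray v2 (1, 0)
  | ray4_right => Ray v4 (1, 0)
  | ray4_down => Ray v4 (0, -1)
  | ray1_down => Ray v1 (0, -1)
  | ray1_left => Ray v1 (-1, 0)
  end.

(* [leaves v c d]: the crease [c] is incident to [v] and leaves it along the
   (not necessarily unit) vector [d]. *)
Definition leaves (R : realType) (v : vertex) (c : crease) (d : R * R) : Prop :=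
  match shape_of R c with
  | Segment a b => (v = a /\ d = vertex_pos R b - vertex_pos R a) \/
                   (v = b /\ d = vertex_pos R a - vertex_pos R b)
  | Ray a d0 => v = a /\ d = d0
  end.

(* The creases at [v] in counterclockwise order, each with the polar angle of
   its direction; [fan_sorted], [fan_polar] and [fan_complete] below check this
   list against the geometry. *)
Definition fan (R : realType) (v : vertex) : seq (R * crease) :=
  match v with
  | v1 => [:: (pi / 4, side41); (3 * pi / 4, side13); (pi, ray1_left);
              (3 * pi / 2, ray1_down)]
  | v2 => [:: (0, ray2_right); (pi / 2, ray2_up); (5 * pi / 4, side32);
              (7 * pi / 4, side24)]
  | v3 => [:: (0, diag34); (pi / 4, side32); (pi / 2, ray3_up);
              (pi, ray3_left); (7 * pi / 4, side13)]
  | v4 => [:: (0, ray4_right); (3 * pi / 4, side24); (pi, diag34);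
              (5 * pi / 4, side41); (3 * pi / 2, ray4_down)]
  end.

Lemma fan_sorted (R : realType) (v : vertex) :
  sorted (fun x y : R => x < y) (rcons (map fst (fan R v)) (2 * pi)) /\
  (forall x, List.In x (fan R v) -> 0 <= x.1).
Proof.
have pi0 := pi_gt0 R.
split; first by case: v => /=; rewrite ?andbT; repeat (apply/andP; split); lra.
by case: v => x /=; intuition; subst x => /=; lra.
Qed.

Lemma fan_complete (R : realType) (v : vertex) (c : crease) (d : R * R) :
  leaves v c d -> exists theta, List.In (theta, c) (fan R v).
Proof.
by case: c => /=; rewrite /leaves /=; intuition; subst v; eexists; simpl; eauto 7.
Qed.

Lemma fan_polar (R : realType) (v : vertex) (theta : R) (c : crease) :
  List.In (theta, c) (fan R v) ->
  exists2 r : R, 0 < r & leaves v c (r * cos theta, r * sin theta).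
Proof.
have q0 : 0 < cos (pi / 4 : R).
  by apply: cos_gt0_pihalf; have := pi_gt0 R; lra.
have qE : sin (pi / 4 : R) = cos (pi / 4).
  have := tan_piquarter R; rewrite /tan => /(congr1 ( *%R^~ (cos (pi / 4)))).
  by rewrite divfK ?lt0r_neq0// mul1r.
have E3 : 3 * pi / 4 = pi / 4 + pi / 2 :> R by lra.
have E5 : 5 * pi / 4 = pi / 4 + pi :> R by lra.
have E7 : 7 * pi / 4 = pi / 4 + pi / 2 + pi :> R by lra.
have E2 : 3 * pi / 2 = pi / 2 + pi :> R by lra.
have qV : (cos (pi / 4))^-1 * cos (pi / 4) = 1 :> R by rewrite mulVf ?lt0r_neq0.
have q1 : 0 < (cos (pi / 4 : R))^-1 by rewrite invr_gt0.
have subE (a b a' b' : R) : (a, b) - (a', b') = (a - a', b - b') by [].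
case: v => /=; intuition;
  match goal with H : _ = (theta, c) |- _ => case: H => <- <- end;
  rewrite /leaves /= ?E3 ?E5 ?E7 ?E2
    ?(cosDpi, sinDpi, cosDpihalf, sinDpihalf, cospi, sinpi, cos_pihalf,
      sin_pihalf, cos0, sin0, qE);
  first [ by exists 1; [exact: ltr01 | intuition; congr pair; lra]
        | by exists 2; [lra | rewrite !subE; intuition;
                              first [left; split=> //; congr pair; lra
                                    |right; split=> //; congr pair; lra]]
        | by exists (cos (pi / 4))^-1 => //; rewrite ?mulrN qV !subE;
             first [left; split=> //; congr pair; lra
                   |right; split=> //; congr pair; lra] ].
Qed.

(* Rotation by [rho] about the axis [(cos theta, sin theta, 0)], acting on
   column vectors: Rodrigues' formula, with [K] the matrix of the cross product
   with the axis. *)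
Definition rotation (R : realType) (theta rho : R) : 'M[R]_3 :=
  let K : 'M[R]_3 := \matrix_(i < 3, j < 3)
    nth 0 (nth [::]
      [:: [:: 0           ; 0         ; sin theta  ];
          [:: 0           ; 0         ; - cos theta];
          [:: - sin theta ; cos theta ; 0          ]] i) j in
  1 + sin rho *: K + (1 - cos rho) *: (K ^+ 2).

(* Assignments of folding angles, with the product topology of R^13. *)
Definition folding (R : realType) := {ptws crease -> R}.

Definition rigid_state (R : realType) (rho : folding R) : Prop :=
  (forall c, - pi <= rho c <= pi) /\
  (forall v, \prod_(x <- fan R v) rotation x.1 (rho x.2) = 1).

Definition rigid_path (R : realType) (gamma : R -> folding R) : Prop :=
  {within `[0, 1], continuous gamma} /\
  (forall t, t \in `[0, 1] -> rigid_state (gamma t)).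

(* Signs of [side13], [side32], [side24], [side41], in this order. *)
Definition standard_patterns (R : realType) : seq (R * R * R * R) :=
  [:: (1, 1, 1, 1); (-1, -1, -1, -1)].

Definition isoarea_patterns (R : realType) : seq (R * R * R * R) :=
  [:: (1, -1, 1, -1); (-1, 1, -1, 1)].

Definition unfolded (R : realType) (rho : folding R) : Prop :=
  forall c, rho c = 0.

Definition square_twist_state (R : realType) (s1 s2 s3 s4 : R)
    (rho : folding R) : Prop :=
  [/\ rho diag34 = 0,
      forall c, c <> diag34 -> rho c = pi \/ rho c = - pi &
      [/\ rho side13 = s1 * pi, rho side32 = s2 * pi,
          rho side24 = s3 * pi & rho side41 = s4 * pi]].

(* Main.v *)
Require Import Defs.
From mathcomp Require Import all_boot all_order all_algebra.
From mathcomp Require Import all_classical all_reals all_analysis.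
From mathcomp Require Import ring lra.

Set Implicit Arguments.
Unset Strict Implicit.
Unset Printing Implicit Defensive.

Import Order.TTheory GRing.Theory Num.Theory.
Import numFieldNormedType.Exports.

Local Open Scope classical_set_scope.
Local Open Scope ring_scope.

(** Fold centrally symmetrically and write [t] for the tangent of half the
folding angle of [side32]. With [e = -1] in the standard case and [e = 1] in the
iso-area case, put [k = 1 - e * sqrt 2]. The degree-4 vertices [v1], [v2] force
the tangent [k * t] on [side13], and then closing up at [v3] is a quadratic
equation for the tangent of the diagonal, with roots [- sqrt 2 * t] and
[sqrt 2 / (k * t)]. Follow the first root until [t] is infinite: all four sides
and the diagonal are then folded flat, and the two halves of the square
coincide. In this position the diagonal can be unfolded while all other creases
except [ray3_up] and [ray4_down] stay fixed: those two turn along with it and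
end flat.
The vertex conditions are checked on unit quaternions, where they become
polynomial identities in the half-angles. *)

(** * Quaternions and the matrices of their conjugation action *)

Section Quaternions.
Context {R : comNzRingType}.
Implicit Types p q : R * R * R * R.

Definition quat_mul p q : R * R * R * R :=
  let: (a, b, c, d) := p in
  let: (a', b', c', d') := q in
  (a * a' - b * b' - c * c' - d * d', a * b' + b * a' + c * d' - d * c',
   a * c' - b * d' + c * a' + d * b', a * d' + b * c' - c * b' + d * a').

Lemma quat_mulA : associative quat_mul.
Proof.
move=> [[[a b] c] d] [[[e f] g] h] [[[i j] k] l] /=.
by congr pair; [congr pair; [congr pair|]|]; ring.
Qed.

Lemma quat_mulq1 : right_id (1, 0, 0, 0) quat_mul.
Proof.
by move=> [[[a b] c] d] /=; congr pair; [congr pair; [congr pair|]|]; ring.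
Qed.

Lemma quat_mul_planar (a b c d a' b' c' : R) :
  quat_mul (a, b, c, d) (a', b', c', 0) =
  (a * a' - b * b' - c * c', a * b' + b * a' - d * c',
   a * c' + c * a' + d * b', b * c' - c * b' + d * a').
Proof. by congr pair; [congr pair; [congr pair|]|]; ring. Qed.

Definition quat_norm q : R :=
  let: (a, b, c, d) := q in a ^+ 2 + b ^+ 2 + c ^+ 2 + d ^+ 2.

Lemma quat_normM p q : quat_norm (quat_mul p q) = quat_norm p * quat_norm q.
Proof. by case: p => [[[a b] c] d]; case: q => [[[e f] g] h] /=; ring. Qed.

(* [quat_norm q] times the rotation [v |-> q v q^-1] of vector quaternions. *)
Definition quat_mx q : 'M[R]_3 :=
  let: (a, b, c, d) := q in
  \matrix_(i < 3, j < 3) nth 0 (nth [::]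
    [:: [:: a ^+ 2 + b ^+ 2 - c ^+ 2 - d ^+ 2; 2 * (b * c - a * d);
            2 * (b * d + a * c)];
        [:: 2 * (b * c + a * d); a ^+ 2 - b ^+ 2 + c ^+ 2 - d ^+ 2;
            2 * (c * d - a * b)];
        [:: 2 * (b * d - a * c); 2 * (c * d + a * b);
            a ^+ 2 - b ^+ 2 - c ^+ 2 + d ^+ 2]] i) j.

Lemma quat_mxM p q : quat_mx (quat_mul p q) = quat_mx p * quat_mx q.
Proof.
case: p => [[[a b] c] d]; case: q => [[[e f] g] h].
apply/matrixP => i j; rewrite !mxE !big_ord_recl big_ord0 !mxE.
case: i => [[|[|[|//]]] ?]; case: j => [[|[|[|//]]] ?] /=; ring.
Qed.

Lemma quat_mx_scalar a : quat_mx (a, 0, 0, 0) = (a ^+ 2)%:M.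
Proof.
apply/matrixP => i j; rewrite !mxE.
by case: i => [[|[|[|//]]] ?]; case: j => [[|[|[|//]]] ?] /=; ring.
Qed.

End Quaternions.

(** * Crease rotations as unit quaternions *)

Section Rotations.
Context {R : realType}.
Implicit Types theta h : R.

(** Here [h] is half the rotation angle, as usual for unit quaternions. *)
Definition rotation_quat theta h : R * R * R * R :=
  (cos h, sin h * cos theta, sin h * sin theta, 0).

Lemma rotation_quat_mx theta h :
  rotation theta (2 * h) = quat_mx (rotation_quat theta h).
Proof.
have E : 2 * h = h *+ 2 by rewrite mulr_natl.
have Es : sin h ^+ 2 = 1 - cos h ^+ 2 := sin2cos2 h.
have Et : sin theta ^+ 2 = 1 - cos theta ^+ 2 := sin2cos2 theta.
apply/matrixP => i j.
rewrite /rotation E sin_mulr2n cos_mulr2n expr2 !mxE !big_ord_recl big_ord0.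
rewrite !mxE.
by case: i => [[|[|[|//]]] ?]; case: j => [[|[|[|//]]] ?] /=; ring: Es Et.
Qed.

(** A product of unit quaternions has norm 1, so once its vector part vanishes it is 1 or -1. Both
    give the identity matrix, hence three equations suffice and the sign need not be tracked. *)
Lemma prod_rotation_eq1 (I : Type) (s : seq (R * I)) (h : I -> R) :
  let q := foldr quat_mul (1, 0, 0, 0)
             [seq rotation_quat x.1 (h x.2) | x <- s] in
  [/\ q.1.1.2 = 0, q.1.2 = 0 & q.2 = 0] ->
  \prod_(x <- s) rotation x.1 (2 * h x.2) = 1.
Proof.
move=> q q0.
have q_mx : \prod_(x <- s) rotation x.1 (2 * h x.2) = quat_mx q.
  rewrite /q; elim: s {q q0} => [|x s IH].
    by rewrite big_nil [RHS]quat_mx_scalar expr1n.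
  by rewrite big_cons IH rotation_quat_mx -quat_mxM.
have q1 : quat_norm q = 1.
  rewrite /q; elim: s {q q0 q_mx} => [|x s IH]; first by rewrite /=; ring.
  rewrite [LHS]quat_normM IH mulr1 /=.
  have Et := sin2cos2 x.1; have Es := sin2cos2 (h x.2).
  by ring: Et Es.
rewrite q_mx; case: q q0 q1 {q_mx} => [[[a b] c] d] [].
move=> b0 c0 d0; simpl in b0, c0, d0; subst b c d.
by rewrite /quat_norm expr0n !addr0 quat_mx_scalar => ->.
Qed.

Lemma cos_piquarter : cos (pi / 4 : R) = Num.sqrt 2 / 2.
Proof.
have q0 : 0 < cos (pi / 4 : R).
  by apply: cos_gt0_pihalf; have := pi_gt0 R; lra.
have r0 : 0 < Num.sqrt 2 :> R by rewrite sqrtr_gt0.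
have r2 : Num.sqrt 2 ^+ 2 = 2 :> R by rewrite sqr_sqrtr.
have E : cos (pi / 4 *+ 2 : R) = 0.
  by rewrite -mulr_natl -cos_pihalf; congr cos; lra.
rewrite cos_mulr2n in E; nra.
Qed.

Lemma sin_piquarter : sin (pi / 4 : R) = Num.sqrt 2 / 2.
Proof.
rewrite -cos_piquarter -[RHS]cosN -[LHS]cosBpihalf; congr cos; lra.
Qed.

End Rotations.

(** The pointwise topology is the supremum of the topologies induced by the coordinates, so
    convergence can be tested on one coordinate at a time. *)
Lemma continuous_ptws (T : topologicalType) (I : Type) (Y : topologicalType)
    (f : T -> {ptws I -> Y}) :
  (forall i, continuous (fun x => f x i)) -> continuous f.
Proof.
move=> cf x; apply/cvg_sup => i U [V [[W oW <-] Wfx] WU].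
apply: (filterS WU); rewrite nbhs_filterE /=.
by apply: (cf i x); apply: open_nbhs_nbhs; split.
Qed.

(** * Half folding angles from homogeneous coordinates of their tangents *)

Section HalfAngle.
Context {R : realType}.
Implicit Types C S : R.

(* The polar angle of the point [(C, S)] of the closed right half-plane, by the
   tangent half-angle formula, which stays regular on the axis [C = 0]. *)
Definition half_angle C S : R :=
  2 * atan (S / (C + Num.sqrt (C ^+ 2 + S ^+ 2))).

Lemma half_angle_den_gt0 C S :
  0 <= C -> 0 < C ^+ 2 + S ^+ 2 -> 0 < C + Num.sqrt (C ^+ 2 + S ^+ 2).
Proof. by move=> C0 N0; apply: ltr_wpDl => //; rewrite sqrtr_gt0. Qed.

(** The quotient [y = S / (C + N)] is the tangent of half the polar angle; the double-angle formulas
    recover the normalised point. *)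
Lemma cos_sin_half_angle C S :
  0 <= C -> 0 < C ^+ 2 + S ^+ 2 ->
  let N := Num.sqrt (C ^+ 2 + S ^+ 2) in
  cos (half_angle C S) = N^-1 * C /\ sin (half_angle C S) = N^-1 * S.
Proof.
move=> C0 N0 N; rewrite /half_angle -/N.
have D0 : C + N != 0 by rewrite lt0r_neq0// half_angle_den_gt0.
have Np : 0 < N by rewrite sqrtr_gt0.
have Nn : N != 0 by rewrite lt0r_neq0.
have NE : S ^+ 2 = N ^+ 2 - C ^+ 2 by rewrite sqr_sqrtr ?ltW//; ring.
set y := S / (C + N).
have y2 : 1 + y ^+ 2 = 2 * N / (C + N).
  by rewrite /y expr_div_n NE; field.
have c2 : cos (atan y) ^+ 2 = (C + N) / (2 * N).
  rewrite cos_atan exprVn sqr_sqrtr ?y2 ?invf_div//.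
  by rewrite -y2 addr_ge0// sqr_ge0.
have c0 : cos (atan y) != 0 by rewrite cos_atan invr_eq0 sqrtr_eq0 -ltNge; nra.
have sE : sin (atan y) = y * cos (atan y).
  have := atanK y; rewrite /tan => /(congr1 ( *%R^~ (cos (atan y)))).
  by rewrite divfK.
rewrite !mulr_natl cos_mulr2n sin_mulr2n sE c2.
split; first by field; rewrite Nn.
by rewrite mulrCA -expr2 c2 /y; field; rewrite Nn D0.
Qed.

(** Since [C] is nonnegative, the absolute value of [S] is at most the denominator, so the
    arctangent is taken on [-1, 1]. *)
Lemma half_angle_bound C S :
  0 <= C -> 0 < C ^+ 2 + S ^+ 2 -> - (pi / 2) <= half_angle C S <= pi / 2.
Proof.
move=> C0 N0.
have D0 := half_angle_den_gt0 C0 N0.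
have : `|S / (C + Num.sqrt (C ^+ 2 + S ^+ 2))| <= 1.
  rewrite normrM normfV (gtr0_norm D0) ler_pdivrMr// mul1r.
  apply: (@le_trans _ _ (Num.sqrt (C ^+ 2 + S ^+ 2))); last by rewrite lerDr.
  by rewrite -sqrtr_sqr ler_sqrt ?lerDr ?sqr_ge0// ltW.
rewrite ler_norml => /andP[/le_atan + /le_atan].
by rewrite /half_angle atanN !atan1; lra.
Qed.

Lemma half_angleC0 C : half_angle C 0 = 0.
Proof. by rewrite /half_angle mul0r atan0 mulr0. Qed.

Lemma half_angle0S S : S != 0 -> half_angle 0 S = Num.sg S * (pi / 2).
Proof.
move=> S0; rewrite /half_angle add0r expr0n /= add0r sqrtr_sqr.
rewrite {1}[S]numEsg mulfK ?normr_eq0//.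
have [S_gt0|S_lt0|//] := sgrP S; last by rewrite atanN atan1; lra.
  by rewrite atan0; lra.
by rewrite atan1; lra.
Qed.

Lemma continuous_half_angle (T : topologicalType) (C S : T -> R) :
  continuous C -> continuous S ->
  (forall x, 0 <= C x) -> (forall x, 0 < C x ^+ 2 + S x ^+ 2) ->
  continuous (fun x => half_angle (C x) (S x)).
Proof.
move=> cC cS C0 N0 x; rewrite /half_angle.
apply: cvgM; first exact: cvg_cst.
apply: continuous_comp; last exact: continuous_atan.
apply: cvgM; first exact: cS.
apply: cvgV; first by rewrite lt0r_neq0// half_angle_den_gt0.
apply: cvgD; first exact: cC.
apply: continuous_comp; last exact: sqrt_continuous.
apply: cvgD.
  exact: (@continuous_comp _ _ _ C (fun y : R => y ^+ 2) x (cC x)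
    (@exprn_continuous R 2 (C x))).
exact: (@continuous_comp _ _ _ S (fun y : R => y ^+ 2) x (cS x)
  (@exprn_continuous R 2 (S x))).
Qed.

(** The value of the normalising factor is hidden: in the vertex equations each such factor comes
    out as a common multiple. *)
Lemma half_angleE (C S : R) : 0 <= C -> 0 < C ^+ 2 + S ^+ 2 ->
  exists n, cos (half_angle C S) = n * C /\ sin (half_angle C S) = n * S.
Proof. by move=> C0 N0; eexists; exact: cos_sin_half_angle. Qed.

Lemma half_plane_scale (k C S : R) :
  k != 0 -> 0 < C ^+ 2 + S ^+ 2 -> 0 < C ^+ 2 + (k * S) ^+ 2.
Proof.
move=> k0 N0; have C2 := sqr_ge0 C; have S2 := sqr_ge0 S.
have k2 : 0 < k ^+ 2 by rewrite exprn_even_gt0.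
by rewrite exprMn; nra.
Qed.

Lemma half_plane_pos C S : 0 < C -> 0 < C ^+ 2 + S ^+ 2.
Proof. by move=> C0; rewrite ltr_pwDl ?sqr_ge0// exprn_gt0. Qed.

End HalfAngle.

(** * The folding path: closure at the vertices, continuity, angle bounds and endpoints *)

Section Path.
Context {R : realType}.
Implicit Types e C S f sigma : R.

(* Half the folding angles, as a function of the homogeneous coordinates
   [(C, S)] of [t = S / C] and of half the angle [f] by which the diagonal has
   been unfolded from its flat position; [f] is nonzero only when [C = 0]. *)
Definition fold_half (e C S f : R) (c : crease) : R :=
  let k := 1 - e * Num.sqrt 2 in
  match c with
  | side32 | side41 => half_angle C S
  | side13 | side24 => half_angle C (k * S)
  | ray2_right | ray1_left => half_angle C (e * S)
  | ray2_up | ray1_down => half_angle C (- e * k * S)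
  | ray3_left | ray4_right => half_angle C (- e * S)
  | diag34 => half_angle C (- Num.sqrt 2 * S) + f
  | ray3_up | ray4_down =>
      half_angle (C ^+ 2 + (1 + k) * S ^+ 2) (- e * S * C) - f
  end.

Lemma side_ratio_gtN1 e : e = 1 \/ e = -1 -> 0 < 1 + (1 - e * Num.sqrt 2).
Proof.
have r2 : Num.sqrt 2 ^+ 2 = 2 :> R by rewrite sqr_sqrtr.
have r0 : 0 < Num.sqrt 2 :> R by rewrite sqrtr_gt0.
by case=> ->; nra.
Qed.

Lemma side_ratio_neq0 e : e = 1 \/ e = -1 -> 1 - e * Num.sqrt 2 != 0.
Proof.
have r2 : Num.sqrt 2 ^+ 2 = 2 :> R by rewrite sqr_sqrtr.
have r0 : 0 < Num.sqrt 2 :> R by rewrite sqrtr_gt0.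
by move=> e1; apply/eqP; case: e1 => ->; nra.
Qed.

Lemma sign_neq0 e : e = 1 \/ e = -1 -> e != 0.
Proof. by case=> ->; rewrite ?oppr_eq0 oner_eq0. Qed.

(** The half-angle tangent on [ray3_up] and [ray4_down] is, for [f = 0],
    [- e * t / (1 + (1 + k) * t ^+ 2)]. This is its denominator made homogeneous, positive even at
    [C = 0], where the tangent becomes 0. *)
Lemma ray_den_gt0 e C S : e = 1 \/ e = -1 -> 0 < C ^+ 2 + S ^+ 2 ->
  0 < C ^+ 2 + (1 + (1 - e * Num.sqrt 2)) * S ^+ 2.
Proof.
move=> /side_ratio_gtN1 k0; have [-> | S0] := eqVneq S 0.
  by rewrite expr0n /= mulr0.
by move=> _; rewrite ltr_wpDl ?sqr_ge0// mulr_gt0// exprn_even_gt0.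
Qed.

(** With the normalising factors abstracted, the vector part of each vertex product vanishes by a
    polynomial identity in [C] and [S], and in [cos f] and [sin f] when [C = 0], for each value of
    [e] and modulo [Num.sqrt 2 ^+ 2 = 2]. The alternative [f = 0 \/ C = 0] separates folding the
    sides from unfolding the diagonal. *)
Lemma fold_half_closed e C S f v :
  e = 1 \/ e = -1 -> 0 <= C -> 0 < C ^+ 2 + S ^+ 2 -> f = 0 \/ C = 0 ->
  \prod_(x <- fan R v) rotation x.1 (2 * fold_half e C S f x.2) = 1.
Proof.
move=> e1 C0 N0 fC.
have r2 : Num.sqrt 2 ^+ 2 = 2 :> R by rewrite sqr_sqrtr.
have r0 : Num.sqrt 2 != 0 :> R by rewrite sqrtr_eq0 -ltNge.
have k0 := side_ratio_neq0 e1; have e0 := sign_neq0 e1.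
have trig_scale (k : R) : k != 0 -> exists n,
    cos (half_angle C (k * S)) = n * C /\
    sin (half_angle C (k * S)) = n * (k * S).
  by move=> kn0; apply: half_angleE => //; exact: half_plane_scale.
have [n0 [c0 s0]] := half_angleE C0 N0.
have [n1 [c1 s1]] := trig_scale _ k0.
have [n2 [c2 s2]] := trig_scale _ e0.
have [n3 [c3 s3]] : exists n,
    cos (half_angle C (- e * (1 - e * Num.sqrt 2) * S)) = n * C /\
    sin (half_angle C (- e * (1 - e * Num.sqrt 2) * S)) =
      n * (- e * (1 - e * Num.sqrt 2) * S).
  by apply: trig_scale; rewrite mulf_neq0 ?oppr_eq0.
have [n4 [c4 s4]] : exists n, cos (half_angle C (- e * S)) = n * C /\
    sin (half_angle C (- e * S)) = n * (- e * S).
  by apply: trig_scale; rewrite oppr_eq0.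
have [n5 [c5 s5]] : exists n, cos (half_angle C (- Num.sqrt 2 * S)) = n * C /\
    sin (half_angle C (- Num.sqrt 2 * S)) = n * (- Num.sqrt 2 * S).
  by apply: trig_scale; rewrite oppr_eq0.
set B := C ^+ 2 + (1 + (1 - e * Num.sqrt 2)) * S ^+ 2.
have B0 : 0 < B := ray_den_gt0 e1 N0.
have [n6 [c6 s6]] : exists n, cos (half_angle B (- e * S * C)) = n * B /\
    sin (half_angle B (- e * S * C)) = n * (- e * S * C).
  by apply: half_angleE; [exact: ltW|exact: half_plane_pos].
have E3 : 3 * pi / 4 = pi / 4 + pi / 2 :> R by lra.
have E5 : 5 * pi / 4 = pi / 4 + pi :> R by lra.
have E7 : 7 * pi / 4 = pi / 4 + pi / 2 + pi :> R by lra.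
have E2 : 3 * pi / 2 = pi / 2 + pi :> R by lra.
apply: prod_rotation_eq1.
(* Rebracketing matters: the nested product unfolds to exponential size. *)
case: v; cbn [fan map foldr fst snd fold_half];
  rewrite !quat_mulq1 /rotation_quat ?E3 ?E5 ?E7 ?E2 -/B
    ?(cosDpi, sinDpi, cosDpihalf, sinDpihalf, cospi, sinpi, cos_pihalf,
      sin_pihalf, cos0, sin0, cos_piquarter, sin_piquarter)
    ?mulrN1 ?mulrN ?mulr0 ?mulr1 ?oppr0.
- rewrite quat_mulA !(c0, s0, c1, s1, c2, s2, c3, s3).
  rewrite !quat_mul_planar !(mul0r, mulr0, oppr0, addr0, subr0, add0r).
  by rewrite /quat_mul /=; split; case: e1 => ->; field: r2.
- rewrite quat_mulA !(c0, s0, c1, s1, c2, s2, c3, s3).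
  rewrite !quat_mul_planar !(mul0r, mulr0, oppr0, addr0, subr0, add0r).
  by rewrite /quat_mul /=; split; case: e1 => ->; field: r2.
- rewrite [in X in quat_mul _ (quat_mul _ X)]quat_mulA quat_mulA.
  case: fC => [f0|C00].
    rewrite f0 addr0 subr0 !(c0, s0, c1, s1, c4, s4, c5, s5, c6, s6).
    rewrite !quat_mul_planar.
    rewrite !(mul0r, mulr0, oppr0, addr0, subr0, add0r, opprK).
    by rewrite /quat_mul /B /=; split; case: e1 => ->; field: r2.
  (* At [C = 0] the rotation about [side32] is a half-turn exchanging the axes of [diag34] and
     [ray3_up]. Moved across it, the rotation of the ray by [- 2 * f] cancels the extra [2 * f] on
     the diagonal. *)
  rewrite [in sin (half_angle B _ - f)]C00 [in cos (half_angle B _ - f)]C00.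
  rewrite mulr0 half_angleC0 sub0r cosN sinN cosD sinD.
  rewrite !(c0, s0, c1, s1, c4, s4, c5, s5) C00 !quat_mul_planar.
  rewrite !(mul0r, mulr0, oppr0, addr0, subr0, add0r, opprK).
  by rewrite /quat_mul /=; split; case: e1 => ->; field: r2.
- rewrite [in X in quat_mul _ (quat_mul _ X)]quat_mulA quat_mulA.
  case: fC => [f0|C00].
    rewrite f0 addr0 subr0 !(c0, s0, c1, s1, c4, s4, c5, s5, c6, s6).
    rewrite !quat_mul_planar.
    rewrite !(mul0r, mulr0, oppr0, addr0, subr0, add0r, opprK).
    by rewrite /quat_mul /B /=; split; case: e1 => ->; field: r2.
  (* The same cancellation at the opposite corner, across the half-turn about [side41]. *)
  rewrite [in sin (half_angle B _ - f)]C00 [in cos (half_angle B _ - f)]C00.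
  rewrite mulr0 half_angleC0 sub0r cosN sinN cosD sinD.
  rewrite !(c0, s0, c1, s1, c4, s4, c5, s5) C00 !quat_mul_planar.
  rewrite !(mul0r, mulr0, oppr0, addr0, subr0, add0r, opprK).
  by rewrite /quat_mul /=; split; case: e1 => ->; field: r2.
Qed.

Lemma continuous_fold_half (T : topologicalType) e (C S f : T -> R) c :
  e = 1 \/ e = -1 -> continuous C -> continuous S -> continuous f ->
  (forall x, 0 <= C x) -> (forall x, 0 < C x ^+ 2 + S x ^+ 2) ->
  continuous (fun x => fold_half e (C x) (S x) (f x) c).
Proof.
move=> e1 cC cS cf C0 N0.
have e0 := sign_neq0 e1; have k0 := side_ratio_neq0 e1.
have r0 : Num.sqrt 2 != 0 :> R by rewrite sqrtr_eq0 -ltNge.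
have scale (k : R) : k != 0 -> continuous (fun x => half_angle (C x) (k * S x)).
  move=> kn0; apply: continuous_half_angle => //.
    by move=> x; apply: cvgM; [exact: cvg_cst|exact: cS].
  by move=> x; exact: half_plane_scale.
have side : continuous (fun x => half_angle (C x) (S x)).
  exact: continuous_half_angle.
have sq (g : T -> R) : continuous g -> continuous (fun x => g x ^+ 2).
  by move=> cg x; rewrite /GRing.exp/=; apply: cvgM; exact: cg.
have ray : continuous (fun x => half_angle
    (C x ^+ 2 + (1 + (1 - e * Num.sqrt 2)) * S x ^+ 2) (- e * S x * C x) - f x).
  move=> x; apply: cvgB; last exact: cf.
  move: x; apply: continuous_half_angle.
  - move=> x; apply: cvgD; first exact: sq.
    by apply: cvgM; [exact: cvg_cst|exact: sq].
  - move=> x; apply: cvgM; last exact: cC.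
    by apply: cvgM; [exact: cvg_cst|exact: cS].
  - by move=> x; rewrite ltW// ray_den_gt0.
  - by move=> x; rewrite half_plane_pos// ray_den_gt0.
case: c => //=; try (by apply: scale; rewrite ?mulf_neq0 ?oppr_eq0).
move=> x; apply: cvgD; last exact: cf.
by apply: scale; rewrite oppr_eq0.
Qed.

(** At [C = 0] the diagonal starts from the half-angle [- Num.sg S * (pi / 2)], so an [f] of the
    sign of [S] moves it towards 0, while the two rays turning with it have half-angle [- f]. *)
Lemma fold_half_bound e C S f c :
  e = 1 \/ e = -1 -> 0 <= C -> 0 < C ^+ 2 + S ^+ 2 ->
  f = 0 \/ C = 0 /\ 0 <= Num.sg S * f <= pi / 2 ->
  - (pi / 2) <= fold_half e C S f c <= pi / 2.
Proof.
move=> e1 C0 N0 fC.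
have e0 := sign_neq0 e1; have k0 := side_ratio_neq0 e1.
have r0 : 0 < Num.sqrt 2 :> R by rewrite sqrtr_gt0.
have scale (k : R) : k != 0 -> - (pi / 2) <= half_angle C (k * S) <= pi / 2.
  by move=> kn0; apply: half_angle_bound => //; exact: half_plane_scale.
have side := half_angle_bound C0 N0.
have S0 : C = 0 -> S != 0.
  move=> C00; apply: contraTneq N0 => ->.
  by rewrite C00 expr0n /= addr0 ltxx.
have diag : - (pi / 2) <= half_angle C (- Num.sqrt 2 * S) + f <= pi / 2.
  case: fC => [->|[C00 fb]].
    by rewrite addr0 scale// oppr_eq0 lt0r_neq0.
  have Sn := S0 C00.
  rewrite C00 half_angle0S; last by rewrite mulf_neq0// oppr_eq0 lt0r_neq0.
  rewrite sgrM sgrN gtr0_sg// mulN1r.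
  by case: (sgrP S) (S0 C00) fb => // _ _; lra.
have ray : - (pi / 2) <= half_angle
    (C ^+ 2 + (1 + (1 - e * Num.sqrt 2)) * S ^+ 2) (- e * S * C) - f <= pi / 2.
  case: fC => [->|[C00 fb]].
    have B0 := ray_den_gt0 e1 N0.
    rewrite subr0; apply: half_angle_bound; first exact: ltW.
    exact: half_plane_pos.
  rewrite C00 mulr0 half_angleC0 sub0r.
  by case: (sgrP S) (S0 C00) fb => // _ _; lra.
by case: c => //=; apply: scale; rewrite ?mulf_neq0 ?oppr_eq0.
Qed.

(** Up to time 1/2 the third argument is 0 and the tangent [sigma * t / (1 - 2 * t)] runs from 0 to
    infinity. Afterwards [C = 0], only the sign of [S] matters, and the diagonal unfolds. *)
Definition fold_path e sigma (t : R) : folding R := fun c =>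
  2 * fold_half e (Num.max 0 (1 - 2 * t)) (sigma * t)
        (sigma * (pi / 2) * Num.max 0 (2 * t - 1)) c.

Lemma fold_path_rigid e sigma :
  e = 1 \/ e = -1 -> sigma = 1 \/ sigma = -1 -> rigid_path (fold_path e sigma).
Proof.
move=> e1 s1.
have s0 := sign_neq0 s1.
have C0 t : 0 <= Num.max 0 (1 - 2 * t) :> R by rewrite le_max lexx.
(* This holds for every real [t], so continuity can be proved on the whole line and then
   restricted. *)
have N0 t : 0 < Num.max 0 (1 - 2 * t) ^+ 2 + (sigma * t) ^+ 2.
  apply: half_plane_scale => //; have [t2|t2] := ltP 0 (1 - 2 * t).
    exact: half_plane_pos.
  by rewrite expr0n /= add0r exprn_gt0//; lra.
have st (t : R) : sigma * (pi / 2) * Num.max 0 (2 * t - 1) = 0 \/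
     Num.max 0 (1 - 2 * t) = 0.
  have [t1|t1] := ltP 0 (1 - 2 * t); last by right.
  by left; rewrite max_l ?mulr0//; lra.
have cont_mul2 : continuous (fun t : R => 2 * t).
  by move=> x; apply: cvgM; [exact: cvg_cst|exact: cvg_id].
have cont_max (g : R -> R) :
    continuous g -> continuous (fun t => Num.max 0 (g t)).
  move=> cg x; apply: (@continuous_max R _ (fun=> 0) g); last exact: cg.
  exact: cvg_cst.
split=> [|t /itvP t01].
  apply: continuous_subspaceT; apply: continuous_ptws => c x.
  apply: cvgM; first exact: cvg_cst.
  move: x; apply: continuous_fold_half => //.
  - apply: cont_max => x; apply: cvgB; [exact: cvg_cst|exact: cont_mul2].
  - by move=> x; apply: cvgM; [exact: cvg_cst|exact: cvg_id].
  - move=> x; apply: cvgM; first exact: cvg_cst.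
    apply: (cont_max (fun t => 2 * t - 1)) => {}x.
    by apply: cvgB; [exact: cont_mul2|exact: cvg_cst].
split=> [c|v]; last exact: fold_half_closed.
suff : - (pi / 2) <= fold_half e (Num.max 0 (1 - 2 * t)) (sigma * t)
        (sigma * (pi / 2) * Num.max 0 (2 * t - 1)) c <= pi / 2.
  by rewrite /fold_path; lra.
apply: fold_half_bound => //.
have [->|Ct0] := st t; [by left|right; split=> //].
have p0 := pi_gt0 R.
have t0 : 0 < t.
  by move: Ct0; have [t1|t1] := ltP 0 (1 - 2 * t); lra.
have t1 : t <= 1 by rewrite t01.
have m : 0 <= Num.max 0 (2 * t - 1) <= 1.
  by have [t2|t2] := ltP 0 (2 * t - 1); lra.
have ss : Num.sg (sigma * t) * sigma = 1.
  by rewrite sgrM (gtr0_sg t0) mulr1; case: s1 => ->; rewrite ?sgrN sgr1; ring.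
rewrite !mulrA ss mul1r; nra.
Qed.

Lemma fold_path0 e sigma : unfolded (fold_path e sigma 0).
Proof.
move=> c; rewrite /fold_path /fold_half !mulr0 !mul0r.
have -> : Num.max 0 (0 - 1) = 0 :> R by rewrite max_l//; lra.
by case: c; rewrite !(mulr0, half_angleC0, addr0, subr0).
Qed.

(** At [C = 0] each half-angle before adding [f] is decided by a sign. As [Num.sqrt 2] exceeds 1,
    [k] has sign [- e], so adjacent sides agree for [e = -1] and alternate for [e = 1]. *)
Lemma fold_path1 e sigma :
  e = 1 \/ e = -1 -> sigma = 1 \/ sigma = -1 ->
  square_twist_state (- e * sigma) sigma (- e * sigma) sigma
    (fold_path e sigma 1).
Proof.
move=> e1 s1; rewrite /square_twist_state /fold_path.
have mC : Num.max 0 (1 - 2 * 1) = 0 :> R by rewrite max_l//; lra.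
have mf : Num.max 0 (2 * 1 - 1) = 1 :> R by rewrite max_r//; lra.
rewrite mC mf !mulr1 {mC mf}.
have e0 := sign_neq0 e1; have k0 := side_ratio_neq0 e1; have s0 := sign_neq0 s1.
have r2 : Num.sqrt 2 ^+ 2 = 2 :> R by rewrite sqr_sqrtr.
have r0 : 0 < Num.sqrt 2 :> R by rewrite sqrtr_gt0.
have sg1 x : x = 1 \/ x = -1 -> Num.sg x = x :> R.
  by case=> ->; rewrite ?sgrN sgr1.
have sgk : Num.sg (1 - e * Num.sqrt 2) = - e.
  by case: e1 => ->; rewrite ?opprK; [apply: ltr0_sg|apply: gtr0_sg]; nra.
have flat x : x != 0 -> 2 * half_angle 0 x = Num.sg x * pi.
  by move=> x0; rewrite half_angle0S//; lra.
have flatpm (x : R) :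
    x != 0 -> 2 * half_angle 0 x = pi \/ 2 * half_angle 0 x = - pi.
  by move=> x0; rewrite flat//; case: (sgrP x) x0 => // _ _; [left|right]; ring.
split.
(* The flat diagonal has half-angle [- sigma * (pi / 2)], exactly undone by the final [f]. *)
- rewrite /= half_angle0S; last by rewrite mulf_neq0// oppr_eq0 lt0r_neq0.
  by rewrite sgrM sgrN gtr0_sg// (sg1 _ s1); ring.
(* What [flatpm] leaves are [ray3_up] and [ray4_down], which end at [- sigma * pi]. *)
- case=> //= _; try (by apply: flatpm; rewrite ?mulf_neq0 ?oppr_eq0);
    rewrite mulr0 half_angleC0 sub0r;
    case: s1 => ->; [right|left|right|left]; lra.
- by rewrite /= !flat ?mulf_neq0// sgrM sgk (sg1 _ s1).
Qed.

End Path.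

Theorem mainTheorem3 (R : realType) (s1 s2 s3 s4 : R)
    (hs : (s1, s2, s3, s4) \in standard_patterns R ++ isoarea_patterns R) :
  exists gamma : R -> folding R,
    [/\ rigid_path gamma,
        unfolded (gamma 0) &
        square_twist_state s1 s2 s3 s4 (gamma 1)].
Proof.
(* In all four patterns opposite sides have equal signs, so [sigma = s2] and [e = - s1 * s2]
   determine the pattern. *)
have [e [sigma [e1 sigma1 [-> -> -> ->]]]] : exists e sigma : R,
    [/\ e = 1 \/ e = -1, sigma = 1 \/ sigma = -1 &
        [/\ s1 = - e * sigma, s2 = sigma, s3 = - e * sigma & s4 = sigma]].
  move: hs; rewrite !inE !xpair_eqE.
  move=> /or4P[] /andP[/andP[/andP[/eqP -> /eqP ->] /eqP ->] /eqP ->].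
  - by exists (-1), 1; split; [right|left|split; ring].
  - by exists (-1), (-1); split; [right|right|split; ring].
  - by exists 1, (-1); split; [left|right|split; ring].
  - by exists 1, 1; split; [left|left|split; ring].
exists (fold_path e sigma); split.
- exact: fold_path_rigid.
- exact: fold_path0.
- exact: fold_path1.
Qed.
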